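(* Let $(X,d)$ be a metric space with at least three points. Then $\dim_1(X) = +\infty$ if and only if every finite subset of $X$ lies in some bisector. In particular, if $X$ is the union of an increasing sequence $B_1\subset B_2\subset\cdots$ of bisectors, then $\dim_1(X) = +\infty$.
   Context: A subset $S$ of a metric space $(X,d)$ is a ($1$-)metric generator for $X$ if for any two distinct points $u,v\in X$ there is $w\in S$ with $d(u,w)\neq d(v,w)$. $\dim_1(X)$ is the infimum of $|S|$ over all $1$-metric generators $S$ for $X$, where $|S|$ is the number of elements if $S$ is finite and $|S|=+\infty$ if $S$ is infinite; thus $\dim_1(X)=+\infty$ if and only if no finite subset of $X$ is a metric generator. For distinct $u,v\in X$, the bisector of $u$ and $v$ is $B(u|v)=\{x\in X: d(x,u)=d(x,v)\}$; a bisector is a set of the form $B(u|v)$ with $u\neq v$. *)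

(* Defs.v *)
From HB Require Import structures.
From mathcomp Require Import all_boot all_order all_algebra.
From mathcomp Require Import all_classical all_reals all_analysis.

Set Implicit Arguments.
Unset Strict Implicit.
Unset Printing Implicit Defensive.

Local Open Scope classical_set_scope.

Definition metric_generator (R : realType) (X : metricType R) (S : set X) : Prop :=
  forall u v : X, u <> v -> exists2 w, S w & mdist u w <> mdist v w.

(* [counting S] is the number of elements of [S] if [S] is finite, and [+oo]
   otherwise. *)
Definition dim1 (R : realType) (X : metricType R) : \bar R :=
  ereal_inf [set counting S | S in @metric_generator R X].

Definition bisector (R : realType) (X : metricType R) (u v : X) : set X :=
  [set x | mdist x u = mdist x v].

Definition is_bisector (R : realType) (X : metricType R) (B : set X) : Prop :=
  exists u v : X, u <> v /\ B = bisector u v.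

(* Main.v *)
Require Import Defs.
From HB Require Import structures.
From mathcomp Require Import all_boot all_order all_algebra.
From mathcomp Require Import all_classical all_reals all_analysis.

Local Open Scope classical_set_scope.

(** A set fails to be a metric generator exactly when some pair [u <> v] is resolved by none of its
    points, that is, when all its points lie in [bisector u v] ([sub_bisectorNgenerator]). Since
    [dim1 X] is infinite exactly when no finite set is a generator ([dim1_pinfty]), the equivalence
    follows. For an increasing cover by bisectors, a finite set already lies in one of them
    ([finite_sub_bigcup_nondecreasing]). *)

Lemma sub_bisectorNgenerator {R : realType} {X : metricType R} (F : set X) :
  (exists2 B, is_bisector B & F `<=` B) <-> ~ metric_generator F.
Proof.
split=> [[_ [u [v [uv ->]]] FB] /(_ _ _ uv)[w /FB /= e]|nG].
  by rewrite ![mdist _ w]metric_sym.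
apply: contrapT => nB; apply: nG => u v uv.
apply: contrapT => nw; apply: nB.
exists (bisector u v); first by exists u, v.
move=> w Fw /=; apply: contrapT => duv; apply: nw.
by exists w => //; rewrite ![mdist _ w]metric_sym.
Qed.

(** An infimum in the extended reals is [+oo] only if every member is, and [counting] takes the
    value [+oo] on infinite sets only. *)
Lemma dim1_pinfty {R : realType} {X : metricType R} :
  dim1 X = +oo%E <-> forall F : set X, finite_set F -> ~ metric_generator F.
Proof.
rewrite /dim1 ereal_inf_pinfty; split=> [cnt F finF GF|infG _ [S GS <-]].
  have /= := cnt _ (ex_intro2 _ _ F GF erefl).
  by rewrite /counting asboolT.
by rewrite /counting asboolF //= => /infG.
Qed.

(** Each point of [F] enters the chain at some index; as [F] is finite, these indices have a
    maximum, and it works for all points. The induction runs on a list enumerating [F]. *)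
Lemma finite_sub_bigcup_nondecreasing {T : eqType} (F : set T) (B : nat -> set T) :
  (forall n, B n `<=` B n.+1) -> finite_set F -> F `<=` \bigcup_n B n ->
  exists n, F `<=` B n.
Proof.
move=> incB /finite_seqP[s ->]; elim: s => [|x s IHs] sB.
  by exists 0%N => ?.
have homoB : {homo B : m n / (m <= n)%N >-> m `<=` n}.
  apply: homo_leq incB => [A|A C D]; [exact: subset_refl|exact: subset_trans].
have [|n sBn] := IHs; first by move=> y ys; apply: sB; rewrite /= inE ys orbT.
have [|m _ Bmx] := sB x; first exact: mem_head.
exists (maxn m n) => y /=; rewrite inE => /predU1P[->|/sBn].
  exact: homoB (leq_maxl m n) _ Bmx.
exact: homoB (leq_maxr m n) _.
Qed.

Theorem theorem4p1 (R : realType) (X : metricType R)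
    (X3 : exists x y z : X, [/\ x <> y, x <> z & y <> z]) :
  (dim1 X = +oo%E <->
   forall F : set X, finite_set F -> exists2 B, is_bisector B & F `<=` B) /\
  (forall B : nat -> set X,
     (forall n, is_bisector (B n)) ->
     (forall n, B n `<=` B n.+1) ->
     \bigcup_n B n = [set: X] ->
     dim1 X = +oo%E).
Proof.
have dimP : dim1 X = +oo%E <->
    forall F : set X, finite_set F -> exists2 B, is_bisector B & F `<=` B.
  by rewrite dim1_pinfty; split=> H F finF; apply/sub_bisectorNgenerator/H.
split=> // B bisB incB covB; apply/dimP => F finF.
have [|n FBn] := finite_sub_bigcup_nondecreasing F B incB finF.
  by rewrite covB.
by exists (B n).
Qed.
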